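(* Fix a constant integer $K \geq 1$ and a load $\alpha$ with $0 < \alpha < 1$. For $1 \le i \le K$, let $X_{i,n}$ denote the (random) fraction of the $n$ cells that hold a key of age at least $i$ after $\alpha n$ keys have been inserted, using Robin Hood hashing with fully random probe sequences, into an initially empty table with $n$ cells. Let $s'_i(\alpha)$ denote the value at final load $\alpha$ of the solution of the system of differential equations described in the context. Then for every $1 \le i \le K$ and every $\epsilon > 0$, for all sufficiently large $n$, $$\Pr\big(|X_{i,n} - s'_i(\alpha)| > \epsilon\big) \le C_1 \exp(-n C_2(\epsilon)),$$ where $C_1>0$ is a constant depending only on $K$ and $\alpha$, and $C_2(\epsilon)>0$ is a constant depending only on $K$, $\alpha$ and $\epsilon$.
   Context: Robin Hood hashing (insertions only): a hash table has $n$ cells, and $\alpha n$ keys (assumed an integer) are inserted one after another. Each key $K_i$ has an infinite probe sequence $K_{i1}, K_{i2}, \dots$ of cells, all entries independent and uniformly distributed over the $n$ cells. A key that is making its $j$-th probe (i.e. examining cell $K_{ij}$) has age $j$; a key placed in the cell given by its $j$-th probe has age $j$. To insert a new key, it starts with age 1. At each step the key currently being placed, say with age $j$, examines the cell given by its $j$-th probe. If the cell is empty, the key is placed there and the insertion ends. Otherwise the collision is resolved in favor of the key with larger age: if the key residing in the cell has strictly smaller age than the key being placed, the resident key is displaced, the key being placed takes the cell, and the displaced key becomes the key being placed (continuing with its next probe, so its age increases by 1); otherwise the key being placed continues with its next probe (its age increases by 1). Limiting differential equations: define functions $s_i(t)$, $t \ge 0$, $i \ge 1$, by $s_i(0)=0$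 for all $i$ and $$\frac{ds_i}{dt} = (1-s_i)\prod_{j=1}^{i-1} s_j \quad (i \ge 1),$$ (the empty product being 1, so $ds_1/dt = 1-s_1$). For a load $\beta \in [0,1)$ set $s'_i(\beta) = s_i(-\ln(1-\beta))$; equivalently $s'_i(0)=0$ and $\frac{ds'_i}{d\beta} = \frac{p_i(1-s'_i)}{1-\beta}$ with $p_i = \prod_{j=1}^{i-1} s'_j$. *)

(* Defs.v *)
From HB Require Import structures.
From mathcomp Require Import all_boot all_order all_algebra.
From mathcomp Require Import all_classical all_reals all_analysis.

Set Implicit Arguments.
Unset Strict Implicit.
Unset Printing Implicit Defensive.

Import Order.TTheory GRing.Theory Num.Theory.
Import numFieldNormedType.Exports.

Local Open Scope classical_set_scope.
Local Open Scope ring_scope.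

Section RobinHood.
Variables (key : choiceType) (n : nat).

(* A cell is empty ([None]) or holds a key together with its age. *)
Definition table := {ffun 'I_n -> option (key * nat)}.

Definition empty_table : table := [ffun=> None].

Definition put (T : table) (c : 'I_n) (x : key * nat) : table :=
  [ffun d => if d == c then Some x else T d].

(* [probe k] is the infinite probe sequence of the key [k].  Ages start at 1
   but [probe k] is indexed from 0, so the j-th probe is [probe k j.-1]. *)
Variable probe : key -> nat -> 'I_n.

(* One probe of the key being placed (second component, with its age); the
   state is left unchanged once there is no key left to place. *)
Definition rh_step (st : table * option (key * nat)) :
    table * option (key * nat) :=
  let: (T, pending) := st in
  if pending is Some (k, j) then
    let c := probe k j.-1 in
    match T c with
    | None => (put T c (k, j), None)
    | Some (k', j') =>
        if (j' < j)%N then (put T c (k, j), Some (k', j'.+1))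
        else (T, Some (k, j.+1))
    end
  else st.

Definition rh_inserts (T : table) (k : key) (T' : table) : Prop :=
  exists N, iter N rh_step (T, Some (k, 1%N)) = (T', None).

(* [rh_inserts T k] holds of at most one table.  If the insertion never ends,
   which has probability 0 for random probes as long as some cell is empty,
   the table is by convention left unchanged. *)
Definition rh_insert (T : table) (k : key) : table :=
  xget T [set T' | rh_inserts T k T'].

Definition rh_table (ks : seq key) : table := foldl rh_insert empty_table ks.

End RobinHood.

Definition has_age_ge (key : choiceType) (n : nat) (T : table key n) (i : nat)
    (c : 'I_n) : bool :=
  if T c is Some (_, j) then (i <= j)%N else false.

Definition frac_age_ge (R : realType) (key : choiceType) (n : nat)
    (T : table key n) (i : nat) : R :=
  #|[pred c | has_age_ge T i c]|%:R / n%:R.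

Definition mutually_independent (d : measure_display) (Omega : measurableType d)
    (R : realType) (P : probability Omega R) (I : choiceType) (U : Type)
    (X : I -> Omega -> U) : Prop :=
  forall (J : seq I) (B : I -> set U), uniq J ->
    P (\bigcap_(k in [set` J]) (X k @^-1` B k)) =
    (\prod_(k <- J) P (X k @^-1` B k))%E.

(* 'I_n carries the discrete sigma-algebra: measurability is required of the
   preimage of every subset. *)
Definition iid_uniform (d : measure_display) (Omega : measurableType d)
    (R : realType) (P : probability Omega R) (I : choiceType) (n : nat)
    (X : I -> Omega -> 'I_n) : Prop :=
  [/\ forall k (B : set 'I_n), measurable (X k @^-1` B),
      forall k (c : 'I_n), P (X k @^-1` [set c]) = (n%:R^-1)%:E
    & mutually_independent P X].

Definition rh_rate (R : realType) (s : nat -> R -> R) (i : nat) (t : R) : R :=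
  (1 - s i t) * \prod_(1 <= j < i) s j t.

(* s i is a solution on [0, +oo[ for every i >= 1; the derivative at 0 is
   one-sided.  Values at negative times and s 0 are irrelevant. *)
Definition rh_ode (R : realType) (s : nat -> R -> R) : Prop :=
  forall i, (1 <= i)%N ->
    [/\ s i 0 = 0,
        h^-1 * (s i h - s i 0) @[h --> 0^'+] --> rh_rate s i 0
      & forall t : R, 0 < t -> is_derive t 1 (s i) (rh_rate s i t)].

(* The solution as a function of the load b = 1 - exp(- t). *)
Definition at_load (R : realType) (s : nat -> R -> R) (i : nat) (b : R) : R :=
  s i (- ln (1 - b)).

(* Main.v *)
(* A key of age [j] that probes a cell of age [a] (with [a = 0] for an empty
   cell) leaves age [max a j] in the cell and age [1 + min a j] pending.
   Listing all probes of a run one after another, the cells probed are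
   independent and uniform, because a key never repeats a probe.  Let [Q i] be
   the number of probes made at age at least [i] and [S i] the number of cells
   of age at least [i].  A probe at age at least [i] hits a uniform cell and
   lifts it to age at least [i], so [(n - S i) * (1 - 1 / n) ^ (- Q i)] is a
   martingale with bounded increments, and its exponential moments show that it
   stays close to its initial value [n], up to exponentially small probability.
   Hence [S i / n] is close to [1 - exp (- Q i / n)].  When the run ends,
   [S 1 = alpha * n] determines [Q 1], and the exact identity
   [Q i = Q (i + 1) + S i] determines all other [Q i] recursively.  The limits
   obey [q (i + 1) = q i - 1 + exp (- q i)] and [s i = 1 - exp (- q i)], which is
   also the explicit solution of the differential equations. *)
Require Import Defs.
From HB Require Import structures.
From mathcomp Require Import all_boot all_order all_algebra.
From mathcomp Require Import all_classical all_reals all_analysis.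
From mathcomp Require Import ring lra zify.

Set Implicit Arguments.
Unset Strict Implicit.
Unset Printing Implicit Defensive.

Import Order.TTheory GRing.Theory Num.Theory.
Import numFieldNormedType.Exports.

Local Open Scope classical_set_scope.
Local Open Scope ring_scope.

(** * Adaptive sampling of an i.i.d. family *)

Lemma bigsetU_fin (T : Type) (I : finType) (F : I -> set T) :
  \big[setU/set0]_i F i = \bigcup_i F i.
Proof.
rewrite -bigcup_seq; apply/seteqP; split=> x [i _ Fi]; exists i => //=.
exact: mem_index_enum.
Qed.

Section AdaptiveSampling.
Variables (I : choiceType) (n : nat) (St : Type).
Variables (nxt : St -> option I) (upd : St -> 'I_n -> St).

Definition sample_step (x : I -> 'I_n) (st : St) : St :=
  if nxt st is Some i then upd st (x i) else st.

(** The expectation of [F] after at most [N] draws, each uniform on the cells. Being a finite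
    recursion, it reduces the later estimates to finite sums. *)
Fixpoint sample_mean (R : realType) (N : nat) (F : St -> R) (st : St) : R :=
  if N is N'.+1 then
    if nxt st is Some _ then n%:R^-1 * \sum_c sample_mean N' F (upd st c)
    else F st
  else F st.

Lemma iter_sample_step_halt x N st :
  nxt st = None -> iter N (sample_step x) st = st.
Proof. by move=> h; elim: N => //= N ->; rewrite /sample_step h. Qed.

Lemma iter_sample_step_nxt x N st i : nxt st = Some i ->
  iter N.+1 (sample_step x) st = iter N (sample_step x) (upd st (x i)).
Proof. by move=> h; rewrite iterSr {2}/sample_step h. Qed.

Lemma sample_mean_sum (R : realType) N (A : Type) (r : seq A) (P : pred A)
    (F : A -> St -> R) st :
  sample_mean N (fun st' => \sum_(a <- r | P a) F a st') st =
  \sum_(a <- r | P a) sample_mean N (F a) st.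
Proof.
elim: N st => [|N IH] st //=; case: (nxt st) => // _.
rewrite -mulr_sumr exchange_big /=; congr (_ * _).
by apply: eq_bigr => c _; rewrite IH.
Qed.

Section Invariant.
Variables (R : realType) (inv : nat -> St -> Prop).
Hypothesis inv_halt : forall l st, inv l st -> nxt st = None -> inv l.+1 st.
Hypothesis inv_upd : forall l st i c,
  inv l st -> nxt st = Some i -> inv l.+1 (upd st c).

Lemma le_sample_mean N l (F G : St -> R) st :
  (forall st', inv (l + N) st' -> F st' <= G st') -> inv l st ->
  sample_mean N F st <= sample_mean N G st.
Proof.
elim: N l st => [|N IH] l st FG ist /=; first by apply: FG; rewrite addn0.
case E: (nxt st) => [i|].
  rewrite ler_wpM2l ?invr_ge0 // ler_sum // => c _; apply: (IH l.+1).
    by move=> st'; rewrite addSnnS; exact: FG.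
  exact: inv_upd E.
by apply: FG; elim: N.+1 => [|N' IH']; rewrite ?addn0 ?addnS //; exact: inv_halt.
Qed.

(** A chain that halts early collects fewer than [N] factors; [1 <= rho] makes up for the missing
    ones. *)
Lemma sample_mean_supermartingale N l (F : St -> R) (rho : R) st :
  1 <= rho -> (forall st', 0 <= F st') ->
  (forall l' st' i, (l' < l + N)%N -> inv l' st' -> nxt st' = Some i ->
     n%:R^-1 * \sum_c F (upd st' c) <= rho * F st') ->
  inv l st -> sample_mean N F st <= rho ^+ N * F st.
Proof.
move=> rho1 F0; have rho0 : 0 <= rho by exact: le_trans rho1.
elim: N l st => [|N IH] l st Fstep ist /=; first by rewrite expr0 mul1r.
case E: (nxt st) => [i|]; last by rewrite ler_peMl // exprn_ege1.
apply: (@le_trans _ _ (rho ^+ N * (n%:R^-1 * \sum_c F (upd st c)))).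
  rewrite mulrCA [_ ^+ N * _]mulr_sumr ler_wpM2l ?invr_ge0 // ler_sum // => c _.
  apply: (IH l.+1); last exact: inv_upd E.
  by move=> l' st' i' l'N; apply: Fstep; rewrite -addSnnS.
rewrite exprSr -mulrA ler_wpM2l ?exprn_ge0 //.
by apply: Fstep ist E; rewrite addnS ltnS leq_addr.
Qed.

End Invariant.

Variables (R : realType) (d : measure_display) (Omega : measurableType d).
Variables (P : probability Omega R) (X : I -> Omega -> 'I_n).

(** Splitting on the value of the next sample turns the event into a finite union at each step. *)
Lemma measurable_iter_sample_step N (Q : set St) st :
  (forall k B, measurable (X k @^-1` B)) ->
  measurable [set w | Q (iter N (sample_step (X^~ w)) st)].
Proof.
move=> mX; elim: N st => [|N IH] st.
  have [h|h] := pselect (Q st).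
    rewrite (_ : mkset _ = setT) //; apply/seteqP; split => w //=.
  rewrite (_ : mkset _ = set0) //; apply/seteqP; split => w //=.
case E: (nxt st) => [i|].
  rewrite (_ : mkset _ = \big[setU/set0]_(c < n) (X i @^-1` [set c] `&`
     [set w | Q (iter N (sample_step (X^~ w)) (upd st c))])).
    by apply: bigsetU_measurable => c _; apply: measurableI.
  rewrite bigsetU_fin; apply/seteqP; split => w.
    by rewrite /mkset (iter_sample_step_nxt _ _ E) => h; exists (X i w).
  by case=> c _ [<-]; rewrite /mkset (iter_sample_step_nxt _ _ E).
have [h|h] := pselect (Q st).
  rewrite (_ : mkset _ = setT) //; apply/seteqP; split => // w _.
  by rewrite /mkset iter_sample_step_halt.
rewrite (_ : mkset _ = set0) //; apply/seteqP; split => // w.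
by rewrite /mkset iter_sample_step_halt.
Qed.

Hypothesis Xiid : iid_uniform P X.
Variable fresh : seq I -> St -> Prop.
Hypothesis fresh_nxt : forall J st i, fresh J st -> nxt st = Some i -> i \notin J.
Hypothesis fresh_upd : forall J st i c,
  fresh J st -> nxt st = Some i -> fresh (i :: J) (upd st c).

(* Conditionally on the already revealed samples, indexed by [J], the next
   sample is uniform because its index is not in [J]. *)
Lemma sample_mean_ge_cylinder N (Q : pred St) J (B : I -> set 'I_n) st :
  uniq J -> fresh J st ->
  (P ((\bigcap_(k in [set` J]) (X k @^-1` B k)) `&`
     [set w | Q (iter N (sample_step (X^~ w)) st)])
   <= P (\bigcap_(k in [set` J]) (X k @^-1` B k)) *
      (sample_mean N (fun st' => (Q st')%:R) st)%:E)%E.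
Proof.
have [mX PX indX] := Xiid.
have mcyl (J' : seq I) B' : measurable (\bigcap_(k in [set` J']) (X k @^-1` B' k)).
  by apply: fin_bigcap_measurable => [|k _]; [exact: finite_seq|exact: mX].
(* If the run does not move, [Q] is decided by [st'], and both sides are explicit. *)
have halt (J' : seq I) B' N' st' :
    (forall w, iter N' (sample_step (X^~ w)) st' = st') ->
    (P ((\bigcap_(k in [set` J']) (X k @^-1` B' k)) `&`
       [set w | Q (iter N' (sample_step (X^~ w)) st')])
     <= P (\bigcap_(k in [set` J']) (X k @^-1` B' k)) * ((Q st')%:R)%:E)%E.
  move=> hst; case E: (Q st'); rewrite ?mule1 ?mule0.
    rewrite le_measure ?inE //.
    by apply: measurableI => //; exact: (measurable_iter_sample_step _ Q).
  rewrite (_ : _ `&` _ = set0) ?measure0 //; apply/seteqP; split => // w [_] /=.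
  by rewrite hst E.
elim: N J B st => [|N IH] J B st uJ fJ; first exact: halt.
case E: (nxt st) => [i|]; last first.
  by rewrite [sample_mean _ _ _]/= E; apply: (halt _ _ N.+1) => w;
     rewrite iter_sample_step_halt.
rewrite [sample_mean _ _ _]/= E; have iJ := fresh_nxt fJ E.
set C := \bigcap_(k in _) _.
(* The cylinder is enlarged by the sample revealed at [i]. As [i] is not in [J], independence
   contributes exactly one factor [1 / n]. *)
pose B' c k := if k == i then [set c] else B k.
have CB' c : \bigcap_(k in [set` i :: J]) (X k @^-1` B' c k) =
             C `&` X i @^-1` [set c].
  apply/seteqP; split=> w.
    move=> h; split; last first.
      by have := h i; rewrite /B' /= mem_head eqxx; apply.
    move=> k /= kJ; have := h k; rewrite /B' /= inE kJ orbT => /(_ isT).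
    by case: eqP => // ki; rewrite -ki kJ in iJ.
  move=> [h1 h2] k /=; rewrite inE /B'; case: eqP => [-> _ //|_ /= kJ].
  exact: h1.
have PB' c : P (\bigcap_(k in [set` i :: J]) (X k @^-1` B' c k)) =
             (P C * (n%:R^-1)%:E)%E.
  rewrite indX /=; last by rewrite iJ.
  rewrite big_cons /B' eqxx PX muleC; congr (_ * _)%E.
  rewrite indX //; rewrite big_seq [in RHS]big_seq; apply: eq_bigr => k kJ.
  by case: eqP => // ki; rewrite -ki kJ in iJ.
pose D c := (\bigcap_(k in [set` i :: J]) (X k @^-1` B' c k)) `&`
            [set w | Q (iter N (sample_step (X^~ w)) (upd st c))].
have mD c : measurable (D c).
  by apply: measurableI => //; exact: (measurable_iter_sample_step _ Q).
rewrite (_ : _ `&` _ = \big[setU/set0]_(c < n) D c); last first.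
  rewrite bigsetU_fin; apply/seteqP; split => w.
    move=> [Cw]; rewrite /mkset (iter_sample_step_nxt _ _ E) => h.
    by exists (X i w) => //; split => //; rewrite CB'.
  case=> c _; rewrite /D CB' => -[[Cw e] h]; split => //.
  by rewrite /mkset (iter_sample_step_nxt _ _ E) (e : X i w = c).
rewrite measure_bigsetU_ord //; last first.
  apply/trivIsetP => a b _ _ ab; apply/seteqP; split => // w.
  by rewrite /D !CB' => -[[[_ /= ea] _] [[_ /= eb] _]]; rewrite -ea -eb eqxx in ab.
apply: (@le_trans _ _ (\sum_(c < n) (P C * (n%:R^-1)%:E *
    (sample_mean N (fun st' => (Q st')%:R) (upd st c))%:E))%E).
  apply: lee_sum => c _; rewrite -(PB' c); apply: IH => /=; first by rewrite iJ.
  exact: fresh_upd.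
rewrite -ge0_sume_distrr; last first.
  by move=> c _; rewrite lee_fin; elim: N {IH D mD} (upd st c) => [|N IH] s //=;
     case: nxt => // _; rewrite mulr_ge0 ?invr_ge0 ?sumr_ge0.
by rewrite EFinM -sumEFin muleA.
Qed.

(** The case where nothing is revealed yet, so that the cylinder is the whole space. *)
Lemma sample_mean_ge_prob N (Q : pred St) st : fresh [::] st ->
  (P [set w | Q (iter N (sample_step (X^~ w)) st)]
   <= (sample_mean N (fun st' => (Q st')%:R) st)%:E)%E.
Proof.
move=> f0; have := @sample_mean_ge_cylinder N Q [::] (fun=> setT) st isT f0.
rewrite (_ : \bigcap_(k in _) _ = setT) ?setTI ?probability_setT ?mul1e //.
by apply/seteqP; split => // w _ k.
Qed.

End AdaptiveSampling.

(** The values of [f] partition the space into countably many measurable pieces, on each of which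
    [g] has a fixed first argument. *)
Lemma measurable_bind (d : measure_display) (Omega : measurableType d)
    (U : countType) (V : Type) (f : Omega -> U) (g : U -> Omega -> V) :
  (forall B : set U, measurable (f @^-1` B)) ->
  (forall u (B : set V), measurable (g u @^-1` B)) ->
  forall B : set V, measurable ((fun w => g (f w) w) @^-1` B).
Proof.
move=> mf mg B.
rewrite (_ : _ @^-1` B = \bigcup_u (f @^-1` [set u] `&` g u @^-1` B)).
  apply: countable_bigcupT_measurable => [|u]; first exact: countableP.
  exact: measurableI.
by apply/seteqP; split => w /=; [exists (f w)|case=> u _ [/= <-]].
Qed.

(** * The limiting differential equations *)

Section Ode.
Variable R : realType.
Implicit Types (s : nat -> R -> R) (t x : R).

Lemma is_derive_expR_comp (f : R -> R) t a :
  is_derive t 1 f a -> is_derive t 1 (fun x => expR (f x)) (a * expR (f t)).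
Proof.
move=> df; rewrite mulrC.
exact: (@is_derive1_comp R expR f t _ a (is_derive_expR _) df).
Qed.

(* [probe_mass i t] is the limit of the number of probes made at age at least
   [i.+1], divided by [n], once [t * n] probes have been made. *)
Fixpoint probe_mass (i : nat) (t : R) : R :=
  if i is i'.+1 then probe_mass i' t - 1 + expR (- probe_mass i' t) else t.

Lemma probe_mass0 i : probe_mass i 0 = 0.
Proof. by elim: i => //= i ->; rewrite oppr0 expR0; ring. Qed.

Lemma probe_mass_ge0 i t : 0 <= t -> 0 <= probe_mass i t.
Proof. by case: i => //= i _; have := expR_ge1Dx (- probe_mass i t); lra. Qed.

(** Differentiating the recursion multiplies the derivative by [1 - exp (- q)] at each level, [q]
    being the previous mass. *)
Lemma is_derive_probe_mass i t :
  is_derive t 1 (probe_mass i) (\prod_(j < i) (1 - expR (- probe_mass j t))).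
Proof.
elim: i => [|i IH].
  by rewrite big_ord0; exact: is_derive_id.
rewrite big_ord_recr /=; set p := \prod_(j < i) _ in IH *.
have dN : is_derive t 1 (fun x => - probe_mass i x) (- p) by exact: is_deriveN.
have dE : is_derive t 1 (fun x => expR (- probe_mass i x))
    (- p * expR (- probe_mass i t)).
  exact: is_derive_expR_comp.
have dC : is_derive t 1 (fun=> (- 1 : R)) 0 by exact: is_derive_cst.
by apply: (is_derive_eq (is_deriveD (is_deriveD IH dC) dE)); ring.
Qed.

(** The one-sided derivative at 0 gives continuity from the right there, which the mean value
    theorem on [[0, t]] requires. *)
Lemma rh_ode_cvg0 s i : rh_ode s -> (1 <= i)%N -> s i x @[x --> 0^'+] --> s i 0.
Proof.
move=> sode i1; have [s0 d0 _] := sode i i1; rewrite s0.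
have c0 : x @[x --> (0:R)^'+] --> (0 : R).
  by apply: cvg_at_right_filter; exact: cvg_id.
have c : x * (x^-1 * (s i x - s i 0)) @[x --> 0^'+] --> (0 : R).
  by rewrite -[X in _ --> X](mul0r (rh_rate s i 0)); exact: cvgM.
apply: cvg_trans c; apply: near_eq_cvg; near=> x.
by rewrite /= s0 subr0 mulrA divff ?mul1r //;
   apply: lt0r_neq0; near: x; exact: nbhs_right_gt.
Unshelve. all: by end_near. Qed.

(* [(1 - s i) * exp (probe_mass i)] has derivative 0. *)
Lemma rh_odeE s i t : rh_ode s -> 0 < t ->
  s i.+1 t = 1 - expR (- probe_mass i t).
Proof.
move=> sode; elim/ltn_ind: i t => i IH t t0.
have [s0 _ ds] := sode i.+1 isT.
pose h x : R := (1 - s i.+1 x) * expR (probe_mass i x).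
have dq x := is_derive_probe_mass i x.
have dh x : 0 < x -> is_derive x 1 h 0.
  move=> x0; have dsx := ds x x0.
  have dC : is_derive x 1 (fun=> (1 : R)) 0 by exact: is_derive_cst.
  have dE : is_derive x 1 (fun x => expR (probe_mass i x))
      (\prod_(j < i) (1 - expR (- probe_mass j x)) * expR (probe_mass i x)).
    exact: is_derive_expR_comp.
  apply: (is_derive_eq (is_deriveM (is_deriveB dC dsx) dE)).
  rewrite /GRing.scale /= /rh_rate big_add1 /= big_mkord.
  have -> : \prod_(j < i) s j.+1 x = \prod_(j < i) (1 - expR (- probe_mass j x)).
    by apply: eq_bigr => j _; exact: IH.
  rewrite -[((fun=> 1) - s i.+1) x]/(1 - s i.+1 x); ring.
have ch x : 0 < x -> {for x, continuous h}.
  by move=> /dh [dx _]; apply: differentiable_continuous; rewrite -derivable1_diffP.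
have cq0 : probe_mass i x @[x --> 0^'+] --> probe_mass i 0.
  apply: cvg_at_right_filter.
  have [dx _] := dq 0.
  by apply: differentiable_continuous; rewrite -derivable1_diffP.
have h0 : h 0 = 1 by rewrite /h s0 probe_mass0 expR0 subr0 mulr1.
have cont : {within `[0, t], continuous h}.
  apply/continuous_within_itvP => //; split.
  - by move=> x; rewrite in_itv /= => /andP[x0 _]; exact: ch.
  - apply: cvgM.
      by apply: cvgB; [exact: cvg_cst|exact: rh_ode_cvg0].
    exact: (cvg_comp _ _ cq0 (@continuous_expR R _)).
  - by apply: cvg_at_left_filter; exact: ch.
(* The derivative of [h] vanishes, so [h t = h 0 = 1], which is solved for [s i.+1 t]. *)
have [|c _] := @MVT R h (fun=> 0) 0 t t0 _ cont.
  by move=> x; rewrite in_itv /= => /andP[x0 _]; exact: dh.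
rewrite mul0r h0 => /eqP; rewrite subr_eq0 => /eqP; rewrite /h => e.
suff : 1 - s i.+1 t = expR (- probe_mass i t) by move=> <-; ring.
apply: (mulIf (lt0r_neq0 (expR_gt0 (probe_mass i t)))).
by rewrite e -expRD addNr expR0.
Qed.

End Ode.

(** * The hashing process as a chain of single probes *)

Section Process.
Variables (key : choiceType) (n : nat).
Implicit Types (T : table key n) (c : 'I_n) (x : key * nat -> 'I_n).

Definition cell_age T c : nat := if T c is Some (_, j) then j else 0%N.

(* The pending keys form a stack, so that the keys not yet inserted are just
   pending keys of age 1 and a whole run is the iteration of a single map. *)
Definition rh_state := (table key n * seq (key * nat))%type.
Implicit Types (st : rh_state).

Definition rh_start (ks : seq key) : rh_state :=
  (empty_table key n, [seq (k, 1%N) | k <- ks]).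

Definition next_probe st : option (key * nat) :=
  if st.2 is (k, j) :: _ then Some (k, j.-1) else None.

(** The cell is an argument instead of being read from a probe sequence, so that this is the update
    map of a sampling chain. *)
Definition probe_cell st c : rh_state :=
  if st.2 is (k, j) :: L then
    match st.1 c with
    | None => (put st.1 c (k, j), L)
    | Some (k', j') =>
        if (j' < j)%N then (put st.1 c (k, j), (k', j'.+1) :: L)
        else (st.1, (k, j.+1) :: L)
    end
  else st.

Local Notation run x := (sample_step next_probe probe_cell x).
Local Notation probe x := (fun k j => x (k, j)).

(** * Agreement of the stack run with successive insertions *)

Lemma rh_step_halt x N T :
  iter N (rh_step (probe x)) (T, None) = (T, None).
Proof. by elim: N => //= N ->. Qed.

(** Finished states are fixed by [rh_step], so two step counts that both finish give the same
    table. *)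
Lemma rh_insertE x T k T' : rh_inserts (probe x) T k T' ->
  rh_insert (probe x) T k = T'.
Proof.
move=> [M hM]; apply: xget_unique; first by exists M.
move=> T1 [M1 hM1]; have [le|/ltnW le] := leqP M M1.
  by move: hM1; rewrite -(subnK le) iterD hM rh_step_halt => -[].
by move: hM; rewrite -(subnK le) iterD hM1 rh_step_halt => -[].
Qed.

(** A displaced key replaces the top of the stack, so the rest [L] is untouched until the first
    insertion ends. *)
Lemma run_first_insertion x N T k j L T' :
  iter N (run x) (T, (k, j) :: L) = (T', [::]) ->
  exists M N' T1, iter M (rh_step (probe x)) (T, Some (k, j)) = (T1, None) /\
    iter N' (run x) (T1, L) = (T', [::]).
Proof.
elim: N T k j => [|N IH] T k j //; rewrite iterSr.
have H T1 k1 j1 : rh_step (probe x) (T, Some (k, j)) = (T1, Some (k1, j1)) ->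
    iter N (run x) (T1, (k1, j1) :: L) = (T', [::]) ->
    exists M N' T1, iter M (rh_step (probe x)) (T, Some (k, j)) = (T1, None) /\
      iter N' (run x) (T1, L) = (T', [::]).
  move=> h /IH [M [N' [T2 [h1 h2]]]]; exists M.+1, N', T2.
  by rewrite iterSr h.
rewrite {2}/sample_step /= /probe_cell /=.
case E: (T _) => [[k' j']|].
  by case: ifP => jj; apply: H; rewrite /rh_step E jj.
move=> h; exists 1%N, N; eexists; split; last exact: h.
by rewrite /= E.
Qed.

Lemma rh_table_run x N ks T :
  iter N (run x) (rh_start ks) = (T, [::]) -> rh_table (probe x) ks = T.
Proof.
rewrite /rh_table /rh_start; elim: ks (empty_table key n) N => [|k ks IH] T0 N /=.
  by rewrite iter_sample_step_halt // => -[].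
move=> /run_first_insertion[M [N' [T1 [h1 /IH <-]]]].
by rewrite (@rh_insertE x _ _ T1) //; exists M.
Qed.

(** * Effect of one probe on the ages *)

Section Ages.
Variables (T : table key n) (k : key) (j : nat) (L : seq (key * nat)) (c : 'I_n).
Let st : rh_state := (T, (k, j) :: L).

Lemma cell_age_probe_cell d : cell_age (probe_cell st c).1 d =
  if d == c then maxn (cell_age T c) j else cell_age T d.
Proof.
rewrite /probe_cell /cell_age /=; case E: (T c) => [[k' j']|] /=.
  case: ifP => jj /=; rewrite ?ffunE; case: eqP => [dc|//]; rewrite ?dc ?E.
    by apply/esym/maxn_idPr/ltnW.
  by apply/esym/maxn_idPl; rewrite leqNgt jj.
by rewrite ffunE; case: eqP => // _; rewrite max0n.
Qed.

(** An empty cell leaves nothing pending, while the formula counts a key of age [1 + min 0 j = 1];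
    hence the condition on [h 1]. *)
Lemma sum_pending_probe_cell (h : nat -> nat) : h 1%N = 0%N ->
  (\sum_(y <- (probe_cell st c).2) h y.2 =
   h (minn (cell_age T c) j).+1 + \sum_(y <- L) h y.2)%N.
Proof.
move=> h1; rewrite /probe_cell /cell_age /=; case E: (T c) => [[k' j']|] /=.
  case: ifP => jj /=; rewrite big_cons /=; congr (h _.+1 + _)%N.
    by apply/esym/minn_idPl/ltnW.
  by apply/esym/minn_idPr; rewrite leqNgt jj.
by rewrite min0n h1.
Qed.

Lemma sum_age_probe_cell (h : nat -> nat) :
  (\sum_d h (cell_age (probe_cell st c).1 d) + h (cell_age T c) =
   \sum_d h (cell_age T d) + h (maxn (cell_age T c) j))%N.
Proof.
rewrite (bigD1 c) // [in RHS](bigD1 c) //= cell_age_probe_cell eqxx.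
under eq_bigr => d /negbTE dc do rewrite cell_age_probe_cell dc.
lia.
Qed.

End Ages.

(** * Counting cells and probes by age *)

Definition cells_ge i st : nat := \sum_c (i <= cell_age st.1 c)%N.

(* A resident key of age [j] has made its first [j] probes and a pending one only
   the first [j.-1], so this counts the probes made so far at age at least [i]. *)
Definition probes_ge i st : nat :=
  (\sum_c ((cell_age st.1 c).+1 - i) + \sum_(y <- st.2) (y.2 - i))%N.

Lemma frac_age_geE (R : realType) i T L : (0 < i)%N ->
  frac_age_ge R T i = (cells_ge i (T, L))%:R / n%:R.
Proof.
move=> i0; rewrite /frac_age_ge /cells_ge -sum1_card big_mkcond /=.
congr (_%:R / _); apply: eq_bigr => c _.
rewrite unfold_in /= /has_age_ge /cell_age; case: (T c) => [[k j]|] //.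
by rewrite leqNgt i0.
Qed.

Lemma cells_ge_le i st : (cells_ge i st <= n)%N.
Proof.
rewrite -[X in (_ <= X)%N]card_ord -sum1_card; apply: leq_sum => c _.
exact: leq_b1.
Qed.

Lemma cells_ge_probe_cell i T k j L c :
  cells_ge i (probe_cell (T, (k, j) :: L) c) =
  (cells_ge i (T, (k, j) :: L) + (cell_age T c < i <= j))%N.
Proof.
have := sum_age_probe_cell T k j L c (fun a => (i <= a)%N).
by rewrite /cells_ge /=; lia.
Qed.

(** The probe replaces the ages [a] (resident) and [j] (pending) by [max a j] and [1 + min a j].
    Their total contribution passes from [(a.+1 - i) + (j - i)] to [(a.+1 - i) + (j.+1 - i)]. *)
Lemma probes_ge_probe_cell i T k j L c : (0 < i)%N ->
  probes_ge i (probe_cell (T, (k, j) :: L) c) =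
  (probes_ge i (T, (k, j) :: L) + (i <= j))%N.
Proof.
move=> i0; rewrite /probes_ge.
rewrite (sum_pending_probe_cell T k j L c (h := fun a => (a - i)%N)); last by lia.
have := sum_age_probe_cell T k j L c (fun a => (a.+1 - i)%N).
by rewrite /= big_cons /=; lia.
Qed.

(** The identity holds cell by cell. The stack must be empty, because pending keys count as probes
    made but occupy no cell. *)
Lemma probes_ge_recr i T :
  probes_ge i (T, [::]) = (probes_ge i.+1 (T, [::]) + cells_ge i (T, [::]))%N.
Proof.
rewrite /probes_ge /cells_ge /= !big_nil !addn0 -big_split /=.
by apply: eq_bigr => c _; lia.
Qed.

Lemma probes_ge_le1 i st : (0 < i)%N -> (probes_ge i st <= probes_ge 1 st)%N.
Proof.
by move=> i0; rewrite leq_add //; apply: leq_sum => c _; rewrite leq_sub2l.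
Qed.

Lemma cells_ge_start i ks : (0 < i)%N -> cells_ge i (rh_start ks) = 0%N.
Proof.
move=> i0; rewrite /cells_ge big1 // => c _.
by rewrite /cell_age /= ffunE leqNgt i0.
Qed.

Lemma probes_ge_start i ks : (0 < i)%N -> probes_ge i (rh_start ks) = 0%N.
Proof.
move=> i0; rewrite /probes_ge !big1_seq //=.
  by move=> y /mapP[k _ ->] /=; lia.
by move=> c _; rewrite /cell_age /= ffunE; lia.
Qed.

(* [m] is the total number of keys, [l] the number of steps made. *)
Definition rh_inv (m l : nat) st : Prop :=
  [/\ forall c k j, st.1 c = Some (k, j) -> (0 < j)%N,
      {in st.2, forall y, (0 < y.2)%N},
      (cells_ge 1 st + size st.2 = m)%N,
      (probes_ge 1 st <= l)%N
    & st.2 <> [::] -> probes_ge 1 st = l].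

Lemma rh_inv_start ks : rh_inv (size ks) 0 (rh_start ks).
Proof.
split => [c k j|y|||].
- by rewrite ffunE.
- by move=> /mapP[k _ ->].
- by rewrite cells_ge_start // size_map.
- by rewrite probes_ge_start.
- by rewrite probes_ge_start.
Qed.

Lemma rh_inv_halt m l st : rh_inv m l st -> next_probe st = None -> rh_inv m l.+1 st.
Proof.
case: st => T [|[k j] L] //= [h1 h2 h3 h4 h5] _; split => //.
exact: leq_trans h4 _.
Qed.

Lemma rh_inv_probe m l st i c :
  rh_inv m l st -> next_probe st = Some i -> rh_inv m l.+1 (probe_cell st c).
Proof.
case: st => T [|[k j] L] //= [h1 h2 h3 h4 h5] _.
have j0 : (0 < j)%N by exact: (h2 (k, j) (mem_head _ _)).
have Qe : probes_ge 1 (probe_cell (T, (k, j) :: L) c) = l.+1.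
  by rewrite probes_ge_probe_cell // h5 // j0 addn1.
have L0 y : y \in L -> (0 < y.2)%N by move=> yL; apply: h2; rewrite inE yL orbT.
split; rewrite ?Qe //.
- move=> d k1 j1; rewrite /probe_cell /=; case E: (T c) => [[k' j']|] /=.
    by case: ifP => jj /=; [rewrite ffunE; case: eqP => [_ [_ <-] //|_]|]; exact: h1.
  by rewrite ffunE; case: eqP => [_ [_ <-] //|_]; exact: h1.
- move=> y; rewrite /probe_cell /=; case E: (T c) => [[k' j']|] /=; last exact: L0.
  by case: ifP => jj /=; rewrite inE => /orP[/eqP-> //|/L0].
- rewrite cells_ge_probe_cell -h3 /= -addnA; congr (_ + _)%N.
  rewrite j0 andbT /probe_cell /cell_age /=; case E: (T c) => [[k' j']|] //=.
  have j'0 := h1 _ _ _ E.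
  by case: ifP => jj /=; lia.
Qed.

(* [J] lists the probes already made. *)
Definition rh_fresh (J : seq (key * nat)) st : Prop :=
  [/\ forall k, (\sum_c (omap fst (st.1 c) == Some k) +
                 count (fun y => y.1 == k) st.2 <= 1)%N,
      {in st.2, forall y, (0 < y.2)%N},
      forall k a c j, (k, a) \in J -> st.1 c = Some (k, j) -> (a < j)%N
    & forall k a j, (k, a) \in J -> (k, j) \in st.2 -> (a < j.-1)%N].

Lemma rh_fresh_start ks : uniq ks -> rh_fresh [::] (rh_start ks).
Proof.
move=> uks; split => // [k|y /mapP[k _ ->] //].
rewrite big1 ?add0n; last by move=> c _; rewrite ffunE.
by rewrite count_map /preim /= count_uniq_mem // leq_b1.
Qed.

(** The index about to be read is [j.-1], and [rh_fresh] keeps the used indices of a pending key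
    strictly below it. *)
Lemma rh_fresh_nxt J st i : rh_fresh J st -> next_probe st = Some i -> i \notin J.
Proof.
case: st => T [|[k j] L] //= [_ _ _ h] [<-]; apply/negP => kJ.
by have := h _ _ j kJ (mem_head _ _); rewrite ltnn.
Qed.

Lemma sum_put (h : option (key * nat) -> nat) T c y :
  (\sum_d h (put T c y d) + h (T c) = \sum_d h (T d) + h (Some y))%N.
Proof.
rewrite (bigD1 c) // [in RHS](bigD1 c) //= ffunE eqxx.
under eq_bigr => d /negbTE dc do rewrite ffunE dc.
lia.
Qed.

(** A probe at age [j] uses index [j.-1]. The key then either rests at age [j] or is pending at age
    [j.+1] with next index [j], and a resident displaced at age [j'] has used only indices below
    [j']. *)
Lemma rh_fresh_upd J st i c :
  rh_fresh J st -> next_probe st = Some i -> rh_fresh (i :: J) (probe_cell st c).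
Proof.
case: st => T [|[k j] L] //= [h1 h2 h3 h4] [<-].
have j0 : (0 < j)%N by exact: (h2 (k, j) (mem_head _ _)).
have L0 y : y \in L -> (0 < y.2)%N by move=> yL; apply: h2; rewrite inE yL orbT.
have kT d j1 : T d = Some (k, j1) -> False.
  move=> E; have := h1 k; rewrite (bigD1 d) //= E !eqxx; lia.
have kL j1 : (k, j1) \in L -> False.
  move=> E; have := h1 k; rewrite /= eqxx; set cnt := count _ L.
  have : (0 < cnt)%N by rewrite -has_count; apply/hasP; exists (k, j1).
  lia.
have L4 k1 a j1 : (k1, a) \in J -> (k1, j1) \in L -> (a < j1.-1)%N.
  by move=> kJ kl; apply: (h4 _ _ _ kJ); rewrite inE kl orbT.
have J4 a : (k, a) \in J -> (a < j.-1)%N.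
  by move=> kJ; apply: (h4 k) => //; exact: mem_head.
rewrite /probe_cell /=; case E: (T c) => [[k' j']|] /=.
  have [jj|jj] := ifP; split => //=.
  - move=> k1; have := sum_put (fun o => (omap fst o == Some k1) : nat) T c (k, j).
    have := h1 k1; rewrite E /=.
    have -> : (Some k == Some k1) = (k == k1) by [].
    have -> : (Some k' == Some k1) = (k' == k1) by [].
    lia.
  - by move=> y; rewrite inE => /orP[/eqP-> //|/L0].
  - move=> k1 a d j1; rewrite inE ffunE => /orP[/eqP[-> ->]|kJ].
      by case: eqP => [_ [<-]|_ /kT //]; lia.
    case: eqP => [_ [e1 e2]|_]; last exact: h3.
    by have := J4 a; rewrite e1 kJ => /(_ isT); lia.
  - move=> k1 a j1; rewrite !inE => /orP[/eqP[-> ->]|kJ] /orP[/eqP[e1 e2]|].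
    + by case: (kT c j'); rewrite E e1.
    + by move/kL.
    + by rewrite e2 /=; apply: (h3 _ _ c _ kJ); rewrite E e1.
    + exact: L4.
  - by move=> y; rewrite inE => /orP[/eqP-> //|/L0].
  - move=> k1 a d j1; rewrite inE => /orP[/eqP[-> _] /kT //|]; exact: h3.
  - move=> k1 a j1; rewrite !inE => /orP[/eqP[-> ->]|kJ] /orP[/eqP|].
    + by case=> ->; lia.
    + by move/kL.

    + by case=> e1 ->; have := J4 a; rewrite -e1 kJ => /(_ isT) /=; lia.
    + exact: L4.
split => //=.
- move=> k1; have := sum_put (fun o => (omap fst o == Some k1) : nat) T c (k, j).
  have := h1 k1; rewrite E /=.
  have -> : (Some k == Some k1) = (k == k1) by [].
  lia.
- move=> k1 a d j1; rewrite inE ffunE => /orP[/eqP[-> ->]|kJ].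
    by case: eqP => [_ [<-]|_ /kT //]; lia.
  case: eqP => [_ [e1 e2]|_]; last exact: h3.
  by have := J4 a; rewrite e1 kJ => /(_ isT); lia.
- move=> k1 a j1; rewrite !inE => /orP[/eqP[-> ->]|kJ]; last exact: L4.
  by move/kL.
Qed.

End Process.

(** * Measurability of the final table *)

Section Measurability.
Variables (key : countType) (n : nat).
Variables (d : measure_display) (Omega : measurableType d).
Variable X : key * nat -> Omega -> 'I_n.
Hypothesis mX : forall k B, measurable (X k @^-1` B).

Let probe w k j := X (k, j) w.

Let next (st : table key n * option (key * nat)) :=
  if st.2 is Some (k, j) then Some (k, j.-1) else None.

(** With all probes equal to [c], [rh_step] examines [c] whatever key is pending, and so becomes an
    update map. *)
Let step st (c : 'I_n) := rh_step (key := key) (fun _ _ => c) st.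

Lemma measurable_rh_step N (Q : set (table key n * option (key * nat))) st :
  measurable [set w | Q (iter N (rh_step (probe w)) st)].
Proof.
have e w : rh_step (probe w) = sample_step next step (X^~ w).
  by apply/funext => -[T [[k j]|]].
under eq_set do rewrite e.
exact: measurable_iter_sample_step.
Qed.

Lemma measurable_rh_insert T k (B : set (table key n)) :
  measurable [set w | B (rh_insert (probe w) T k)].
Proof.
(* Ending within some number of steps is a countable union of events that each read finitely many
   probes; on the complement of [ends setT] the table stays [T]. *)
pose ends (B' : set (table key n)) := \bigcup_N [set w | exists2 T',
  B' T' & iter N (rh_step (probe w)) (T, Some (k, 1%N)) = (T', None)].
have mends B' : measurable (ends B').
  apply: bigcupT_measurable => N.
  exact: (measurable_rh_step _ (fun st => exists2 T', B' T' & st = (T', None))).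
rewrite (_ : mkset _ = ends B `|` (~` ends setT `&` [set _ | B T])).
  apply: measurableU => //; apply: measurableI; first exact: measurableC.
  have [BT|BT] := pselect (B T).
    by rewrite (_ : mkset _ = setT) //; apply/seteqP; split.
  by rewrite (_ : mkset _ = set0) //; apply/seteqP; split.
apply/seteqP; split => w.
  have [[N _ [T' _ e]]|nends] := pselect (ends setT w).
    move=> BT'; left; exists N => //; exists T' => //.
    rewrite -(rh_insertE (x := X^~ w) (T := T) (k := k) (T' := T')) //.
    by exists N.
  rewrite /mkset /rh_insert; case: xgetP => [T' _ + _|_ BT].
    by move=> [N e]; case: nends; exists N => //; exists T'.
  by right.
move=> [[N _ [T' BT' e]]|[nends BT]] /=.
  by rewrite (rh_insertE (x := X^~ w) (T' := T')) //; exists N.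
rewrite /rh_insert; case: xgetP => // T' _ [N e].
by case: nends; exists N => //; exists T'.
Qed.

Lemma measurable_rh_table ks (B : set (table key n)) :
  measurable [set w | B (rh_table (probe w) ks)].
Proof.
(* The empty table is abstracted so that the induction covers every initial table. *)
have [T0 T0E] : exists T0, T0 = empty_table key n by eexists.
rewrite /rh_table -T0E; elim: ks T0 {T0E} B => [|k ks IH] T B /=.
  have [BT|BT] := pselect (B T).
    by rewrite (_ : mkset _ = setT) //; apply/seteqP; split.
  by rewrite (_ : mkset _ = set0) //; apply/seteqP; split.
apply: (measurable_bind (f := fun w => rh_insert (probe w) T k)
  (g := fun T' w => foldl (rh_insert (probe w)) T' ks)) => [B'|T' B'].
  exact: measurable_rh_insert.
exact: IH.
Qed.

End Measurability.

(** * Concentration *)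

Section Estimates.
Variable R : realType.

(** From [exp (- x) >= 1 - x], and from [(1 - x) (1 + x + 2 x^2) = 1 + x^2 (1 - 2 x) >= 1]. *)
Lemma expR_le_quad (x : R) : x <= 2^-1 -> expR x <= 1 + x + 2 * x ^+ 2.
Proof.
move=> x2; have x1 : 0 < 1 - x by lra.
have := expR_ge1Dx (- x); rewrite expRN => h.
have {h} : expR x <= (1 - x)^-1.
  by rewrite -[expR x]invrK lef_pV2 ?posrE ?invr_gt0 ?expR_gt0.
move=> /le_trans; apply; rewrite -[leLHS]mul1r ler_pdivrMr //.
have : 0 <= x ^+ 2 * (1 - 2 * x) by rewrite mulr_ge0 ?sqr_ge0 //; lra.
nra.
Qed.

Lemma expRN_lipschitz (x y : R) : 0 <= x -> 0 <= y ->
  `|expR (- x) - expR (- y)| <= `|x - y|.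
Proof.
wlog xy : x y / x <= y.
  move=> H x0 y0; have [/H|/ltW/H] := leP x y; first exact.
  by rewrite distrC (distrC x); exact.
move=> x0 y0; have exy : expR (- y) <= expR (- x) by rewrite ler_expR lerN2.
rewrite ger0_norm ?subr_ge0 // distrC ger0_norm ?subr_ge0 //.
have -> : - y = - x + (x - y) by ring.
rewrite expRD; have := expR_ge1Dx (x - y).
have e1 : expR (- x) <= 1 by rewrite -expR0 ler_expR oppr_le0.
have := expR_gt0 (- x); nra.
Qed.

(** The inequality [ln z <= z - 1] is applied to [y] and to [1 / y], the latter being at most
    [1 + 2 * delta]. *)
Lemma ln_near1 (y delta : R) : delta <= 2^-1 -> `|y - 1| <= delta ->
  `|ln y| <= 2 * delta.
Proof.
move=> d2; rewrite !ler_norml => /andP[y1 y2]; have y0 : 0 < y by lra.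
have h1 : ln y <= y - 1.
  by have := le_ln1Dx (x := y - 1); rewrite addrCA subrr addr0; apply; lra.
have h2 : ln y^-1 <= y^-1 - 1.
  have := le_ln1Dx (x := y^-1 - 1); rewrite addrCA subrr addr0; apply.
  by rewrite ltrBrDr addNr invr_gt0.
rewrite lnV ?posrE // in h2.
have h3 : y^-1 <= 1 + 2 * delta.
  rewrite -[leLHS]mul1r ler_pdivrMr //.
  have d0 : 0 <= delta by lra.
  have : 0 <= (1 + 2 * delta) * (y - (1 - delta)) by rewrite mulr_ge0 //; lra.
  have : 0 <= delta * (1 - 2 * delta) by rewrite mulr_ge0 //; lra.
  nra.
by apply/andP; split; lra.
Qed.

(** * The martingale and its exponential moments *)

Variables (key : choiceType) (n : nat).
Hypothesis n2 : (2 <= n)%N.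
Implicit Types (st : rh_state key n).

Let n0 : 0 < n%:R :> R. Proof. by rewrite ltr0n; lia. Qed.
Let n1 : 0 < n%:R - 1 :> R. Proof. by rewrite subr_gt0 ltr1n. Qed.
Let nne0 : n%:R != 0 :> R. Proof. exact: lt0r_neq0. Qed.
Let n1ne0 : n%:R - 1 != 0 :> R. Proof. exact: lt0r_neq0. Qed.

(** The inverse of [1 - 1 / n], the probability that a probe misses a given cell. *)
Definition miss_ratio : R := n%:R / (n%:R - 1).

(* Each probe at age at least [i] multiplies the mean number of cells of age
   less than [i] by [1 - 1 / n], so this is a martingale. *)
Definition rh_martingale (i : nat) st : R :=
  (n%:R - (cells_ge i st)%:R) * miss_ratio ^+ probes_ge i st.

Lemma miss_ratio_ge1 : 1 <= miss_ratio.
Proof. rewrite /miss_ratio ler_pdivlMr //; lra. Qed.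

Lemma miss_ratio_gt0 : 0 < miss_ratio.
Proof. by apply: lt_le_trans miss_ratio_ge1. Qed.

(** With the upper bound [1 / (n - 1)] below, this makes [n * ln miss_ratio] close to 1, so that
    [miss_ratio ^+ Q] is close to [exp (Q / n)]. *)
Lemma ln_miss_ratio_ge : n%:R^-1 <= ln miss_ratio.
Proof.
have -> : miss_ratio = (1 + - n%:R^-1)^-1.
  by rewrite /miss_ratio; field; rewrite n1ne0 nne0.
have i1 : n%:R^-1 < 1 :> R by rewrite invf_lt1 // ltr1n.
rewrite lnV ?posrE; last by lra.
by have := @le_ln1Dx R (- n%:R^-1); lra.
Qed.

Lemma ln_miss_ratio_le : ln miss_ratio <= (n%:R - 1)^-1.
Proof.
have -> : miss_ratio = 1 + (n%:R - 1)^-1 by rewrite /miss_ratio; field.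
apply: le_ln1Dx; have : 0 < (n%:R - 1)^-1 :> R by rewrite invr_gt0.
lra.
Qed.

Lemma miss_ratio_expE k : miss_ratio ^+ k = expR (ln miss_ratio * k%:R).
Proof. by rewrite expRM_natr lnK ?posrE // miss_ratio_gt0. Qed.

(** The exponential is expanded to second order around the current value: the linear term averages
    to zero over the cells, and the increment is at most [B] in absolute value. *)
Lemma rh_martingale_step (N l m i : nat) (th B kappa : R) st y :
  (0 < i)%N -> miss_ratio ^+ N <= B -> `|th| * B <= 2^-1 ->
  (l < N)%N -> rh_inv m l st -> next_probe st = Some y ->
  n%:R^-1 * \sum_c expR (th * rh_martingale i (probe_cell st c) + kappa) <=
  expR (2 * (th ^+ 2 * B ^+ 2)) * expR (th * rh_martingale i st + kappa).
Proof.
move=> i0 rB thB lN [_ _ _ Ql _] nst.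
have {Ql} Ql : (probes_ge i st < N)%N.
  by apply: leq_ltn_trans lN; apply: leq_trans Ql; exact: probes_ge_le1.
set v := th ^+ 2 * B ^+ 2; have v0 : 0 <= v by rewrite mulr_ge0 ?sqr_ge0.
have ev : 1 + 2 * v <= expR (2 * v) by exact: expR_ge1Dx.
case: st nst Ql => T [|[k j] L] // _ Ql; set st := (T, _).
set Y := rh_martingale i st; set E := expR (th * Y + kappa).
have E0 : 0 < E by exact: expR_gt0.
(* A probe at age below [i] changes neither count, so the mean is that of a constant. *)
have [ji|ij] := ltnP j i.
  under eq_bigr => c _.
    rewrite /rh_martingale cells_ge_probe_cell probes_ge_probe_cell //.
    rewrite [(i <= j)%N]leqNgt ji andbF !addn0 -/(rh_martingale i st) -/Y -/E.
    over.
  rewrite sumr_const card_ord -[E *+ n]mulr_natl mulKf //.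
  by apply: ler_peMl; [exact: ltW|apply: le_trans ev; lra].
set S := cells_ge i st; set U : R := n%:R - S%:R.
set w := miss_ratio ^+ (probes_ge i st).+1.
have w0 : 0 < w by rewrite exprn_gt0 // miss_ratio_gt0.
have wB : w <= B.
  by apply: le_trans rB; rewrite ler_weXn2l // miss_ratio_ge1.
have U0 : 0 <= U / n%:R.
  by rewrite mulr_ge0 ?invr_ge0 ?ler0n // subr_ge0 ler_nat cells_ge_le.
have U1 : U / n%:R <= 1.
  by rewrite ler_pdivrMr // mul1r /U lerBlDr lerDl.
pose b c : R := (cell_age T c < i)%N%:R.
have sb : \sum_c b c = U.
  apply/eqP; rewrite eq_sym subr_eq -natr_sum -natrD eqr_nat /S /cells_ge.
  rewrite -big_split /= (eq_bigr (fun=> 1%N)) ?sum1_card ?card_ord //.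
  by move=> c _; rewrite ltnNge; case: (i <= cell_age T c)%N.
(* The increment is [w * (U / n - b c)], which sums to zero over [c] by [sb]. *)
have Yc c : rh_martingale i (probe_cell st c) = Y + w * (U / n%:R - b c).
  rewrite /rh_martingale cells_ge_probe_cell probes_ge_probe_cell // ij andbT addn1.
  rewrite -/S -/w natrD -/(b c) /Y /rh_martingale -/S -/U.
  have -> : miss_ratio ^+ probes_ge i st = w * (1 - n%:R^-1).
    rewrite /w exprSr -mulrA; rewrite [X in _ * X](_ : _ = 1) ?mulr1 //.
    by rewrite /miss_ratio; field; rewrite nne0 n1ne0.
  by rewrite /U; field.
have B0 : 0 <= B by exact: le_trans (ltW w0) wB.
have bound c : expR (th * rh_martingale i (probe_cell st c) + kappa) <=
    E * (1 + 2 * v + th * w * (U / n%:R - b c)).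
  rewrite Yc (_ : _ + kappa = (th * Y + kappa) + th * w * (U / n%:R - b c));
    last by ring.
  rewrite expRD -/E ler_pM2l //.
  set x := U / n%:R - b c; set z := th * w * x.
  have x1 : `|x| <= 1.
    have : b c = 0 \/ b c = 1 by rewrite /b; case: ltnP; [right|left].
    by rewrite /x ler_norml => -[] ->; lra.
  have zB : `|z| <= `|th| * B.
    rewrite /z !normrM (gtr0_norm w0) -mulrA ler_wpM2l // -[leRHS]mulr1.
    by apply: ler_pM => //; exact: ltW.
  apply: le_trans (expR_le_quad _) _.
    by apply: le_trans (ler_norm _) _; exact: le_trans thB.
  have : z ^+ 2 <= v.
    have zB' : `|z| <= `|th * B| by rewrite [leRHS]normrM (ger0_norm B0).
    rewrite /v -exprMn -(real_normK (num_real z)) -(real_normK (num_real (th * B))).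
    by rewrite ler_pXn2r ?nnegrE.
  by lra.
apply: (@le_trans _ _ (n%:R^-1 *
    \sum_c (E * (1 + 2 * v + th * w * (U / n%:R - b c))))).
  by rewrite ler_wpM2l ?invr_ge0 ?ler0n // ler_sum.
rewrite -mulr_sumr big_split /= sumr_const card_ord -mulr_sumr sumrB.
rewrite sumr_const card_ord sb.
rewrite (_ : n%:R^-1 * _ = E * (1 + 2 * v)).
  by rewrite mulrC ler_pM2r.
rewrite -[(1 + 2 * v) *+ n]mulr_natl -[(U / n%:R) *+ n]mulr_natl.
by field.
Qed.

Lemma rh_martingale_tail (A i : nat) (B delta : R) (ks : seq key) :
  (0 < i)%N -> (0 < A)%N -> 1 <= B -> miss_ratio ^+ (A * n) <= B ->
  0 < delta -> delta <= 2^-1 ->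
  sample_mean (@next_probe key n) (@probe_cell key n) (A * n)
    (fun st => (delta * n%:R < `|rh_martingale i st - n%:R|)%R%:R) (rh_start n ks)
  <= 2 * expR (- (n%:R * (delta ^+ 2 / (8 * B ^+ 2 * A%:R)))).
Proof.
move=> i0 A0 B1 rB d0 d1; have AR : 1 <= A%:R :> R by rewrite ler1n.
(* This value minimizes the Chernoff exponent [2 * th ^+ 2 * B ^+ 2 * A * n - th * delta * n]. *)
set th := delta / (4 * B ^+ 2 * A%:R).
have B0 : 0 < B by lra.
have th0 : 0 < th by rewrite divr_gt0 // !mulr_gt0 ?exprn_gt0 //; lra.
have thB : th * B <= 2^-1.
  rewrite /th [X in X <= _](_ : _ = delta / (4 * B * A%:R)); last first.
    by field; rewrite !lt0r_neq0 //; lra.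
  rewrite ler_pdivrMr ?mulr_gt0 //; try lra.
  have : 1 <= B * A%:R by rewrite mulr_ege1.
  by nra.
(* [G sg] starts at [exp (- th * delta * n)] and is at least 1 once the deviation in direction [sg]
   reaches [delta * n], so [G 1 + G (-1)] dominates the indicator. *)
pose G sg st := expR (sg * th * rh_martingale i st +
                      (- (sg * th * n%:R) - th * delta * n%:R)).
have key_bound (sg : R) : `|sg| = 1 ->
    sample_mean (@next_probe key n) (@probe_cell key n) (A * n) (G sg)
      (rh_start n ks) <=
    expR (- (n%:R * (delta ^+ 2 / (8 * B ^+ 2 * A%:R)))).
  move=> sg1; have sg2 : sg ^+ 2 = 1 by rewrite -real_normK ?num_real // sg1 expr1n.
  apply: le_trans (sample_mean_supermartingale (inv := rh_inv (size ks))
    (rho := expR (2 * ((sg * th) ^+ 2 * B ^+ 2))) (l := 0) _ _ _ _ _) _.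
  - by move=> l st y c; exact: rh_inv_probe.
  - by rewrite -[leLHS]expR0 ler_expR pmulr_rge0 // mulr_ge0 ?sqr_ge0.
  - by move=> st; exact: expR_ge0.
  - move=> l st y lN; apply: rh_martingale_step lN => //.
    by rewrite normrM sg1 mul1r gtr0_norm.
  - exact: rh_inv_start.
  rewrite -expRM_natl /G /rh_martingale cells_ge_start // probes_ge_start //.
  rewrite -expRD ler_expR exprMn sg2 natrM /th expr0.
  rewrite le_eqVlt; apply/orP; left; apply/eqP.
  by field; rewrite !lt0r_neq0 //; lra.
apply: (@le_trans _ _ (sample_mean (@next_probe key n) (@probe_cell key n) (A * n)
    (fun st => \sum_(sg <- [:: 1; -1]) G sg st) (rh_start n ks))).
  apply: (@le_sample_mean _ _ _ _ _ _ (fun=> fun=> True) _ _ _ 0%N) => // st _.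
  rewrite !big_cons big_nil addr0.
  have ge0 sg : 0 <= G sg st by exact: expR_ge0.
  case: ltP => [|_]; last by rewrite addr_ge0.
  have G1 sg : 0 <= sg * (rh_martingale i st - n%:R) - delta * n%:R -> 1 <= G sg st.
    move=> h; rewrite -[leLHS]expR0 ler_expR.
    by have := mulr_ge0 (ltW th0) h; lra.
  rewrite ltr_normr => /orP[] h.
    have : 1 <= G 1 st by apply: G1; rewrite mul1r; lra.
    by have := ge0 (-1); rewrite mulr1n; lra.
  have : 1 <= G (-1) st by apply: G1; rewrite mulN1r; lra.
  by have := ge0 1; rewrite mulr1n; lra.
rewrite sample_mean_sum !big_cons big_nil addr0.
have := key_bound 1 (normr1 _); have := key_bound (-1) (normrN1 _).
lra.
Qed.

(** If a key were pending, all [A * n] steps would be probes at age at least 1 and [(1 - alpha) * n]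
    cells would be empty. The martingale would then be at least [(1 - alpha) * A * n >= 2 * n],
    above the allowed [3 / 2 * n]. *)
Lemma rh_martingale_finished (alpha delta : R) (A m : nat) st :
  alpha < 1 -> m%:R = alpha * n%:R -> 2 / (1 - alpha) <= A%:R ->
  delta <= 2^-1 -> rh_inv m (A * n) st ->
  `|rh_martingale 1 st - n%:R| <= delta * n%:R -> st.2 = [::].
Proof.
move=> a1 mE A2 d1 [_ _ sz _ Qe]; rewrite ler_norml => /andP[_ hY].
have [//|/eqP L0] := eqVneq st.2 [::].
have Sm : (cells_ge 1 st)%:R <= alpha * n%:R by rewrite -mE ler_nat -sz leq_addr.
have a0 : 0 < 1 - alpha by lra.
rewrite ler_pdivrMr // in A2.
have rA : A%:R <= miss_ratio ^+ (A * n).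
  rewrite miss_ratio_expE; apply: le_trans (expR_ge1Dx _).
  have := ln_miss_ratio_ge; rewrite -(ler_pM2r n0) mulVf // => h.
  have : A%:R * 1 <= A%:R * (ln miss_ratio * n%:R) by rewrite ler_wpM2l.
  by rewrite natrM; lra.
have A0 : 0 <= A%:R :> R by exact: ler0n.
have : (1 - alpha) * n%:R * A%:R <= rh_martingale 1 st.
  rewrite /rh_martingale Qe //; apply: ler_pM => //.
    by rewrite mulr_ge0 // ltW.
  lra.
have : 0 <= (A%:R * (1 - alpha) - 2) * n%:R.
  by rewrite mulr_ge0 ?(ltW n0) // subr_ge0.
have : 0 <= (2^-1 - delta) * n%:R by rewrite mulr_ge0 ?(ltW n0) // subr_ge0.
by move=> p1 p2 p3; exfalso; have := n0; lra.
Qed.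

(** A deterministic statement. The rescaled probe counts [x j] follow the recursion of [probe_mass]
    up to errors of order [delta], and Lipschitz continuity carries this over to the fractions of
    cells. *)
Lemma rh_martingale_estimate (alpha delta : R) (K : nat) st i :
  0 < alpha -> alpha < 1 -> delta <= 2^-1 -> (n%:R - 1)^-1 <= delta ->
  st.2 = [::] -> (cells_ge 1 st)%:R = alpha * n%:R ->
  (forall j, (j < K)%N -> `|rh_martingale j.+1 st - n%:R| <= delta * n%:R) ->
  (i < K)%N ->
  `|(cells_ge i.+1 st)%:R / n%:R - (1 - expR (- probe_mass i (- ln (1 - alpha))))|
  <= (4 ^+ i.+1 + 1) * delta.
Proof.
move=> a0 a1 d1 nd st0 S1 hY; set t := - ln _.
have t0 : 0 <= t by rewrite /t oppr_ge0 ln_le0 //; lra.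
pose x j : R := ln miss_ratio * (probes_ge j.+1 st)%:R.
pose u j : R := 1 - (cells_ge j.+1 st)%:R / n%:R.
have ln0 : 0 <= ln miss_ratio by rewrite ln_ge0 // miss_ratio_ge1.
have x0 j : 0 <= x j by rewrite mulr_ge0.
have u1 j : 0 <= 1 - u j <= 1.
  rewrite /u opprB addrCA subrr addr0 divr_ge0 //= ler_pdivrMr // mul1r ler_nat.
  exact: cells_ge_le.
have yE j : (j < K)%N -> `|u j * expR (x j) - 1| <= delta.
  move=> /hY; rewrite /rh_martingale miss_ratio_expE -/(x j).
  rewrite (_ : _ - n%:R = n%:R * (u j * expR (x j) - 1)); last by rewrite /u; field.
  by rewrite normrM gtr0_norm // mulrC ler_pM2r.
have uq j : (j < K)%N ->
    `|u j - expR (- probe_mass j t)| <= delta + `|x j - probe_mass j t|.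
  move=> /yE h; rewrite (_ : _ - _ = (u j * expR (x j) - 1) * expR (- x j) +
     (expR (- x j) - expR (- probe_mass j t))); last first.
    by rewrite mulrBl -mulrA -expRD subrr expR0; ring.
  apply: le_trans (ler_normD _ _) _; apply: lerD; last first.
    by apply: expRN_lipschitz => //; exact: probe_mass_ge0.
  rewrite normrM [`|expR _|]gtr0_norm ?expR_gt0 // -[leRHS]mulr1.
  by apply: ler_pM => //; rewrite -[leRHS]expR0 ler_expR oppr_le0.
have d0 : 0 < delta by apply: lt_le_trans nd; rewrite invr_gt0.
have xq j : (j < K)%N -> `|x j - probe_mass j t| <= 4 ^+ j.+1 * delta.
  (* At age 1 the load gives [u 0 = 1 - alpha] exactly, so the logarithm of [u 0 * exp (x 0)] is
     [x 0 - t]. *)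
  elim: j => [|j IH] jK.
    have u0 : u 0%N = 1 - alpha by rewrite /u S1 mulfK.
    have := ln_near1 d1 (yE _ jK); rewrite u0 lnM ?posrE ?expR_gt0 //; last by lra.
    rewrite expRK (_ : _ + x 0%N = x 0%N - probe_mass 0 t);
      last by rewrite /= /t; ring.
    by move=> /le_trans; apply; rewrite expr1; lra.
  have jK' := ltnW jK; have := IH jK'; have := uq _ jK'.
  have xS : x j.+1 = x j - ln miss_ratio * n%:R * (1 - u j).
    have stE : (st.1, [::]) = st by rewrite -st0; case: (st).
    by rewrite /x -stE (probes_ge_recr j.+1) stE natrD /u; field.
  have nl : 0 <= ln miss_ratio * n%:R - 1 <= delta.
    have h1 : ln miss_ratio * n%:R <= (n%:R - 1)^-1 * n%:R.
      by rewrite ler_pM2r // ln_miss_ratio_le.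
    have h2 : n%:R^-1 * n%:R <= ln miss_ratio * n%:R.
      by rewrite ler_pM2r // ln_miss_ratio_ge.
    rewrite mulVf // in h2.
    apply/andP; split; first lra.
    apply: le_trans nd; rewrite lerBlDr; apply: le_trans h1 _.
    by rewrite le_eqVlt; apply/orP; left; apply/eqP; field.
  (* With [E = 4 ^+ j.+1], the new error is at most [E * delta + (delta + E * delta) + delta], hence
     at most [4 * E * delta] because [E >= 1]. *)
  have e4 : 1 <= 4 ^+ j.+1 :> R by rewrite exprn_ege1 //; lra.
  rewrite [4 ^+ j.+2]exprS.
  set E := 4 ^+ j.+1 in e4 *; set a := u j - _ => ha hb.
  rewrite xS (_ : _ - probe_mass j.+1 t = (x j - probe_mass j t) + a
      - (ln miss_ratio * n%:R - 1) * (1 - u j)); last by rewrite /a /=; ring.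
  have hc : `|(ln miss_ratio * n%:R - 1) * (1 - u j)| <= delta.
    have /andP[v0 v1] := u1 j; have /andP[l0 l1] := nl.
    by rewrite ger0_norm ?mulr_ge0 // -[leRHS]mulr1 ler_pM.
  apply: le_trans (ler_normB _ _) _; apply: le_trans (lerD (ler_normD _ _) hc) _.
  have : delta <= E * delta by rewrite ler_peMl // ltW.
  lra.
move=> iK; have := uq _ iK; have := xq _ iK.
rewrite (_ : _ - (1 - _) = - (u i - expR (- probe_mass i t)));
  last by rewrite /u; ring.
rewrite normrN; lra.
Qed.

End Estimates.

(** * Union bound over the ages *)

Section Concentration.
Variables (R : realType) (alpha delta eps B : R) (n m K A : nat).
Hypotheses (alpha0 : 0 < alpha) (alpha1 : alpha < 1) (mE : m%:R = alpha * n%:R).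
Hypotheses (delta0 : 0 < delta) (delta1 : delta <= 2^-1).
Hypothesis delta_eps : (4 ^+ K + 1) * delta <= eps.
Hypotheses (n2 : (2 <= n)%N) (n_delta : (n%:R - 1)^-1 <= delta).
Hypotheses (A_ge : 2 / (1 - alpha) <= A%:R) (B_ge1 : 1 <= B).
Hypothesis B_ge : miss_ratio R n ^+ (A * n) <= B.

(** Unless one of the [K] martingales for ages 1 to [K] deviates, the run has finished and the
    deterministic estimate applies. *)
Lemma rh_concentration (d : measure_display) (Omega : measurableType d)
    (P : probability Omega R) (probe : 'I_m * nat -> Omega -> 'I_n) (i : nat) :
  iid_uniform P probe -> (i < K)%N ->
  (P [set w | (eps < `| frac_age_ge R (rh_table (fun (k : 'I_m) (j : nat) =>
        probe (k, j) w) (enum 'I_m)) i.+1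
      - (1 - expR (- probe_mass i (- ln (1 - alpha)))) |)%R] <=
    (K%:R * 2 * expR (- (n%:R * (delta ^+ 2 / (8 * B ^+ 2 * A%:R)))))%R%:E)%E.
Proof.
move=> probe_iid iK; set x := 1 - _.
have A0 : (0 < A)%N.
  by rewrite -(ltr0n R); apply: lt_le_trans A_ge; rewrite divr_gt0 // subr_gt0.
(* Unfinished runs count as failures, since the chain yields [rh_table] only once its stack is
   empty. *)
pose Q (st : rh_state 'I_m n) : bool :=
  (st.2 != [::]) || (eps < `|(cells_ge i.+1 st)%:R / n%:R - x|).
pose bad j (st : rh_state 'I_m n) : R :=
  (delta * n%:R < `|rh_martingale R j.+1 st - n%:R|)%R%:R.
have [mprobe _ _] := probe_iid.
have := @sample_mean_ge_prob _ n _ (@next_probe 'I_m n) (@probe_cell 'I_m n) R _ _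
  P probe probe_iid (@rh_fresh 'I_m n) (@rh_fresh_nxt _ _)
  (fun J st i c => @rh_fresh_upd _ _ J st i c) (A * n) Q (rh_start n (enum 'I_m))
  (rh_fresh_start n (enum_uniq 'I_m)).
move=> hP; apply: (@le_trans _ _ (P [set w | Q (iter (A * n)
    (sample_step (@next_probe 'I_m n) (@probe_cell 'I_m n) (probe^~ w))
    (rh_start n (enum 'I_m)))])).
  apply: le_measure; rewrite ?inE.
  - exact: (measurable_rh_table mprobe (enum 'I_m)
      (fun T => is_true (eps < `|frac_age_ge R T i.+1 - x|))).
  - exact: (measurable_iter_sample_step _ _ _ (fun st => is_true (Q st)) _ mprobe).
  - move=> w; rewrite /mkset /Q.
    case E : (iter _ _ _) => [T [|y L]] //=.
    by rewrite (rh_table_run E) (@frac_age_geE _ _ _ _ T [::]).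
apply: le_trans hP _; rewrite lee_fin.
apply: (@le_trans _ _ (sample_mean (@next_probe 'I_m n) (@probe_cell 'I_m n) (A * n)
    (fun st => \sum_(j < K) bad j st) (rh_start n (enum 'I_m)))).
  apply: (@le_sample_mean _ _ _ _ _ _ (@rh_inv 'I_m n m) _ _ _ 0%N); last first.
  - by have := rh_inv_start n (enum 'I_m); rewrite size_enum_ord.
  - move=> st hst; have bad0 j : 0 <= bad j st by exact: ler0n.
    case Qst : (Q st); last by rewrite sumr_ge0.
    have [[j bj]|nbad] := pselect (exists j : 'I_K,
        delta * n%:R < `|rh_martingale R j.+1 st - n%:R|).
      by rewrite (bigD1 j) //= {1}/bad bj lerDl sumr_ge0.
    have good j : (j < K)%N -> `|rh_martingale R j.+1 st - n%:R| <= delta * n%:R.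
      move=> jK; rewrite leNgt; apply/negP => h; apply: nbad.
      by exists (Ordinal jK).
    have K0 : (0 < K)%N by apply: leq_ltn_trans iK.
    have st0 : st.2 = [::].
      exact: (rh_martingale_finished n2 alpha1 mE A_ge delta1 hst (good 0%N K0)).
    have S1 : (cells_ge 1 st)%:R = alpha * n%:R.
      by case: hst => _ _ + _ _; rewrite st0 addn0 => ->.
    have := rh_martingale_estimate n2 alpha0 alpha1 delta1 n_delta st0 S1 good iK.
    rewrite -/x => h; exfalso; move: Qst.
    rewrite /Q st0 eqxx /= => /lt_le_trans/(_ h).
    apply/negP; rewrite -leNgt; apply: le_trans delta_eps.
    by rewrite ler_pM2r // lerD2r ler_weXn2l // ler1n.
  - by move=> l st y c; exact: rh_inv_probe.
  - exact: rh_inv_halt.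
rewrite sample_mean_sum.
set tail := 2 * expR (- (n%:R * (delta ^+ 2 / (8 * B ^+ 2 * A%:R)))).
apply: (@le_trans _ _ (\sum_(j < K) tail)).
  by apply: ler_sum => j _; exact: rh_martingale_tail.
by rewrite sumr_const card_ord -mulrA mulr_natl.
Qed.

End Concentration.

Theorem theorem2 (R : realType) (K : nat) (alpha : R)
    (hK : (1 <= K)%N) (halpha0 : 0 < alpha) (halpha1 : alpha < 1) :
  exists C1 : R, exists C2 : R -> R,
    0 < C1 /\ (forall eps : R, 0 < eps -> 0 < C2 eps) /\
    forall s : nat -> R -> R, rh_ode s ->
    forall (i : nat) (eps : R), (1 <= i <= K)%N -> 0 < eps ->
    exists n0 : nat, forall n m : nat, (n0 <= n)%N ->
      m%:R = alpha * n%:R ->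
      forall (d : measure_display) (Omega : measurableType d)
        (P : probability Omega R) (probe : 'I_m * nat -> Omega -> 'I_n),
        iid_uniform P probe ->
        let X := fun w : Omega =>
          frac_age_ge R
            (rh_table (fun (k : 'I_m) (j : nat) => probe (k, j) w) (enum 'I_m)) i in
        (P [set w | (eps < `| X w - at_load s i alpha |)%R]
          <= (C1 * expR (- (n%:R * C2 eps)))%R%:E)%E.
Proof.
(* [A * n] steps suffice to finish the run outside the bad events; [B] bounds
   [miss_ratio ^+ (A * n)] because [n * ln miss_ratio <= n / (n - 1) <= 2]. *)
pose A := Num.bound (2 / (1 - alpha)); pose B : R := expR (2 * A%:R).
(* The factor [4 ^+ K + 1] is the largest error amplification over the [K] ages. *)
pose delta (eps : R) : R := Num.min 2^-1 (eps / (4 ^+ K + 1)).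
have K4 : 0 < 4 ^+ K + 1 :> R by rewrite addr_gt0 ?exprn_gt0.
have a1 : 0 < 1 - alpha by rewrite subr_gt0.
have A_ge : 2 / (1 - alpha) <= A%:R.
  by apply/ltW/archi_boundP; rewrite divr_ge0 ?ltW.
have A0 : 0 < A%:R :> R by apply: lt_le_trans A_ge; rewrite divr_gt0.
have delta0 eps : 0 < eps -> 0 < delta eps.
  by move=> e0; rewrite lt_min invr_gt0 ltr0n /= divr_gt0.
have B_ge1 : 1 <= B by rewrite -[leLHS]expR0 ler_expR mulr_ge0 // ltW.
exists (K%:R * 2), (fun eps => delta eps ^+ 2 / (8 * B ^+ 2 * A%:R)).
split; first by rewrite mulr_gt0 // ltr0n.
split=> [eps e0|s s_ode [//|i] eps /= iK e0].
  apply: divr_gt0; first by rewrite exprn_gt0 ?delta0.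
  by do 2!apply: mulr_gt0 => //; rewrite exprn_gt0 ?expR_gt0.
(* Large enough for [n >= 2] and [1 / (n - 1) <= delta eps]. *)
exists (Num.bound (delta eps)^-1 + 2)%N => n m n_ge mE d Omega P probe.
move=> probe_iid; cbv zeta.
have n2 : (2 <= n)%N by apply: leq_trans n_ge; rewrite leq_addl.
have d0 := delta0 _ e0.
have n_delta : (n%:R - 1)^-1 <= delta eps.
  have ib : (delta eps)^-1 <= n%:R - 1.
    have /archi_boundP : 0 <= (delta eps)^-1 by rewrite invr_ge0 ltW.
    by move: n_ge; rewrite -(ler_nat R) natrD; lra.
  by rewrite -[leRHS]invrK lef_pV2 ?posrE ?invr_gt0 // (lt_le_trans _ ib) ?invr_gt0.
have n1 : 0 < n%:R - 1 :> R by rewrite subr_gt0 ltr1n.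
have B_ge : miss_ratio R n ^+ (A * n) <= B.
  rewrite miss_ratio_expE // ler_expR natrM mulrCA mulrC ler_pM2r //.
  apply: (@le_trans _ _ ((n%:R - 1)^-1 * n%:R)).
    by rewrite ler_wpM2r // ln_miss_ratio_le.
  have n2R : 2 <= n%:R :> R by rewrite ler_nat.
  by rewrite mulrC ler_pdivrMr //; lra.
have t0 : 0 < - ln (1 - alpha) by rewrite oppr_gt0 ln_lt0 // a1 /= ltrBlDr ltrDl.
rewrite /at_load (rh_odeE i s_ode t0).
apply: (rh_concentration _ halpha1 mE) => //; first by rewrite ge_min lexx.
by rewrite mulrC -ler_pdivlMr // ge_min lexx orbT.
Qed.
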